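(* Let $n\ge1$. For any $c\in\left[\frac{n-1}{2}\pi,\frac{n+1}{2}\pi\right)$, $$\mathcal{F}_c=\mathcal{P}_1\star F_{c-\frac{\pi}{2}}$$ as subsets of $\mathrm{Sym}^2(\mathbb{R}^{n+1})$.
   Context: $\mathrm{Sym}^2(\mathbb{R}^k)$ is the space of real symmetric $k\times k$ matrices. $\mathcal{P}_1=[0,\infty)\subset\mathbb{R}=\mathrm{Sym}^2(\mathbb{R}^1)$. Lifted Lagrangian angle: for $B\in\mathrm{Sym}^2(\mathbb{R}^n)$ with eigenvalues $\lambda_1(B),\dots,\lambda_n(B)$, $\widetilde\theta(B):=\sum_{i=1}^n\tan^{-1}\lambda_i(B)$, with $\tan^{-1}:\mathbb{R}\to(-\frac{\pi}{2},\frac{\pi}{2})$. For real $a$, $F_a:=\{B\in\mathrm{Sym}^2(\mathbb{R}^n):\widetilde\theta(B)\ge a\}$. Lifted space-time Lagrangian angle: for $A\in\mathrm{Sym}^2(\mathbb{R}^{n+1})$ write $A=\begin{pmatrix}a_{00}&\vec a^{\,T}\\ \vec a&A^+\end{pmatrix}$ with $a_{00}\in\mathbb{R}$, $\vec a\in\mathbb{R}^n$, $A^+\in\mathrm{Sym}^2(\mathbb{R}^n)$. Let $I_n:=\mathrm{diag}(0,1,\dots,1)\in\mathrm{Sym}^2(\mathbb{R}^{n+1})$ and $\mathcal{S}:=\{\mathrm{diag}(0,A^+):A^+\in\mathrm{Sym}^2(\mathbb{R}^n)\}$. Define $\widetilde\Theta(A):=\sum_{i=1}^{n+1}\arg\big(\lambda_i(I_n+\sqrt{-1}A)\big)$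 for $A\notin\mathcal{S}$ (eigenvalues counted with multiplicity; for $A\notin\mathcal{S}$ they lie in $\mathbb{C}\setminus(-\infty,0]$, and $\arg:\mathbb{C}\setminus(-\infty,0]\to(-\pi,\pi)$ is the angle with the positive real axis), and $\widetilde\Theta(A):=\widetilde\theta(A^+)+\frac{\pi}{2}$ for $A\in\mathcal{S}$. Set $\mathcal{F}_c:=\{A\in\mathrm{Sym}^2(\mathbb{R}^{n+1}):\widetilde\Theta(A)\ge c\}$. $\star$-product: for $F\subset\mathrm{Sym}^2(\mathbb{R}^m)$ and $G\subset\mathrm{Sym}^2(\mathbb{R}^n)$, $F\star G\subset\mathrm{Sym}^2(\mathbb{R}^{m+n})$ is the set of matrices $A=\begin{pmatrix}B&C^T\\ C&E\end{pmatrix}$, with $B\in\mathrm{Sym}^2(\mathbb{R}^m)$, $C\in\mathbb{R}^{n\times m}$, $E\in\mathrm{Sym}^2(\mathbb{R}^n)$, such that (i) $B\in F$, and (ii) $\ell_\Gamma^*A:=\Gamma B\Gamma^T+\Gamma C^T+C\Gamma^T+E\in G$ for all $\Gamma\in\mathbb{R}^{n\times m}$. Here it is applied with $m=1$, so $\ell_V^*A=a_{00}VV^T+V\vec a^{\,T}+\vec a V^T+A^+$ for $V\in\mathbb{R}^{n\times1}$. *)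

(* Defs.v *)
From HB Require Import structures.
From mathcomp Require Import all_boot all_order all_algebra.
From mathcomp Require Import complex.
From mathcomp Require Import boolp classical_sets reals trigo.

Set Implicit Arguments.
Unset Strict Implicit.
Unset Printing Implicit Defensive.

Import Order.TTheory GRing.Theory Num.Theory.

Local Open Scope classical_set_scope.
Local Open Scope ring_scope.
Local Open Scope complex_scope.

Definition Sym2 (R : realType) (n : nat) : set 'M[R]_n :=
  [set A | A^T = A].

(* The eigenvalues of A listed with multiplicity, as an (unordered) choice of
   roots of the characteristic polynomial; it is [::] when that polynomial
   does not split over F, which cannot happen in the two cases of interest
   (see char_poly_eigenvalues_complex and char_poly_eigenvalues_sym). *)
Definition eigenvalues (F : fieldType) (n : nat) (A : 'M[F]_n) : seq F :=
  xget [::] [set s : seq F | char_poly A = \prod_(x <- s) ('X - x%:P)].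

(* The argument of a nonzero complex number, in ]-pi, pi] (see carg_polar);
   on the complement of the closed negative axis it lies in ]-pi, pi[.
   At 0 it is a junk value, never used: for symmetric A outside
   singular_set, no eigenvalue of spacetime_mx A lies on the closed negative axis. *)
Definition carg (R : realType) (z : R[i]) : R :=
  let: x +i* y := z in
  let t := acos (x / Num.sqrt (x ^+ 2 + y ^+ 2)) in
  if 0 <= y then t else - t.

Definition theta (R : realType) (n : nat) (B : 'M[R]_n) : R :=
  \sum_(x <- eigenvalues B) atan x.

Definition angle_set (R : realType) (n : nat) (a : R) : set 'M[R]_n :=
  [set B | Sym2 B /\ a <= theta B].

Definition In_mx (R : realType) (n : nat) : 'M[R]_(1 + n) :=
  block_mx 0 0 0 1%:M.

Definition singular_set (R : realType) (n : nat) : set 'M[R]_(1 + n) :=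
  [set block_mx 0 0 0 B | B in @Sym2 R n].

Definition spacetime_mx (R : realType) (n : nat) (A : 'M[R]_(1 + n)) :
    'M[R[i]]_(1 + n) :=
  map_mx (real_complex R) (In_mx R n) + 'i *: map_mx (real_complex R) A.

Definition Theta (R : realType) (n : nat) (A : 'M[R]_(1 + n)) : R :=
  if A \in @singular_set R n then theta (drsubmx A) + pi / 2
  else \sum_(z <- eigenvalues (spacetime_mx A)) carg z.

Definition spacetime_angle_set (R : realType) (n : nat) (c : R) :
    set 'M[R]_(1 + n) :=
  [set A | Sym2 A /\ c <= Theta A].

(* [0, +oo[ viewed inside Sym^2(R^1) *)
Definition P1 (R : realType) : set 'M[R]_1 :=
  [set B | 0 <= B ord0 ord0].

Definition star (R : realType) (m n : nat) (F : set 'M[R]_m) (G : set 'M[R]_n) :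
    set 'M[R]_(m + n) :=
  [set A | exists (B : 'M[R]_m) (C : 'M[R]_(n, m)) (E : 'M[R]_n),
    [/\ Sym2 B, Sym2 E, A = block_mx B C^T C E, F B &
      forall V : 'M[R]_(n, m),
        G (V *m B *m V^T + V *m C^T + C *m V^T + E)]].

Lemma eigenvaluesP (F : fieldType) (n : nat) (A : 'M[F]_n) (s : seq F) :
  char_poly A = \prod_(x <- s) ('X - x%:P) ->
  char_poly A = \prod_(x <- eigenvalues A) ('X - x%:P).
Proof. by move=> As; rewrite /eigenvalues; case: xgetP => [t -> //|/(_ s)]. Qed.

Lemma char_poly_eigenvalues_complex (R : realType) (n : nat) (A : 'M[R[i]]_n) :
  char_poly A = \prod_(x <- eigenvalues A) ('X - x%:P).
Proof.
have [s As] := closed_field_poly_normal (char_poly A).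
apply: (@eigenvaluesP _ _ _ s).
by rewrite {1}As (monicP (char_poly_monic A)) scale1r.
Qed.

Lemma char_poly_conj (F : fieldType) (n : nat) (P D : 'M[F]_n) :
  P \in unitmx -> char_poly (invmx P *m D *m P) = char_poly D.
Proof.
move=> Pu; rewrite /char_poly.
have -> : char_poly_mx (invmx P *m D *m P) =
    map_mx polyC (invmx P) *m char_poly_mx D *m map_mx polyC P.
  rewrite /char_poly_mx mulmxBr mulmxBl -!map_mxM; congr (_ - _).
  by rewrite scalar_mxC -mulmxA -map_mxM mulVmx// map_mx1 mulmx1.
rewrite !det_mulmx mulrAC -det_mulmx -map_mxM mulVmx// map_mx1 det1.
by rewrite mul1r.
Qed.

Lemma char_poly_eigenvalues_sym (R : realType) (n : nat) (A : 'M[R]_n) :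
  Sym2 A -> char_poly A = \prod_(x <- eigenvalues A) ('X - x%:P).
Proof.
move=> As; pose f := real_complex R; pose B := map_mx f A.
have Bh : B \is hermsymmx.
  apply/is_hermitianmxP; rewrite expr0 scale1r; apply/matrixP => i j.
  by rewrite !mxE -{1}As mxE; apply/esym/CrealP/complex_realP; eexists.
have /hermitian_normalmx/orthomx_spectralP BE := Bh.
have /mxOverP dR := hermitian_spectral_diag_real Bh.
pose s := [seq complex.Re (spectral_diag B 0 i) | i <- enum 'I_n].
apply: (@eigenvaluesP _ _ _ s); apply: (map_poly_inj f).
rewrite map_char_poly -/B rmorph_prod /= big_map big_enum /=.
rewrite {1}BE char_poly_conj ?spectral_unit//.
rewrite char_poly_trig ?diag_mx_is_trig//; apply: eq_bigr => i _.
rewrite rmorphB /= map_polyX map_polyC /= !mxE eqxx mulr1n /f.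
by rewrite RRe_real ?dR.
Qed.

Lemma carg_polar (R : realType) (z : R[i]) : z != 0 ->
  [/\ - pi < carg z <= pi &
      z = `|z| * (cos (carg z) +i* sin (carg z))].
Proof.
case: z => x y z0; rewrite /carg normc_def /=.
set r := Num.sqrt _; have r2 : r ^+ 2 = x ^+ 2 + y ^+ 2.
  by rewrite sqr_sqrtr// addr_ge0// sqr_ge0.
have r0 : 0 < r.
  rewrite sqrtr_gt0 lt0r addr_ge0 ?sqr_ge0// andbT paddr_eq0 ?sqr_ge0//.
  by rewrite !sqrf_eq0; apply: contra z0 => /andP[/eqP-> /eqP->].
have rN0 := lt0r_neq0 r0.
have xr2 : (x / r) ^+ 2 + (y / r) ^+ 2 = 1.
  by rewrite !expr_div_n -mulrDl -r2 divff// expf_neq0.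
have xr : -1 <= x / r <= 1.
  by rewrite -ler_norml -(@expr_le1 _ 2)// real_normK ?num_real// -xr2 lerDl sqr_ge0.
have [/andP[t0 tpi] ct] := acos_def xr.
have st : sin (acos (x / r)) = `|y / r|.
  by rewrite sin_acos// -xr2 addrC addKr sqrtr_sqr.
have yr : `|y / r| = `|y| / r by rewrite normrM normfV (gtr0_norm r0).
have pi0 := pi_gt0 R.
case: (leP 0 y) => y0.
  split; first by rewrite tpi andbT (lt_le_trans _ t0)// oppr_lt0.
  rewrite ct st yr ger0_norm//; simpc.
  by rewrite ![r * _]mulrC !divfK.
have tlt : acos (x / r) < pi.
  rewrite lt_neqAle tpi andbT; apply/eqP => tE.
  move: st; rewrite tE sinpi yr => /esym/eqP.
  by rewrite mulf_eq0 invr_eq0 (negbTE rN0) orbF normr_eq0 lt_eqF.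
split; first by rewrite ltrN2 tlt (le_trans _ (ltW pi0))// oppr_le0.
rewrite cosN sinN ct st yr ltr0_norm//; simpc.
by rewrite ![r * _]mulrC !divfK.
Qed.

(* Main.v *)
Require Import Defs.
From mathcomp Require Import all_boot all_order all_algebra complex.
From mathcomp Require Import boolp classical_sets reals trigo.
From mathcomp Require Import topology normedtype realfun ring lra.

Set Implicit Arguments.
Unset Strict Implicit.
Unset Printing Implicit Defensive.

Import Order.TTheory GRing.Theory Num.Theory numFieldNormedType.Exports.

Local Open Scope classical_set_scope.
Local Open Scope ring_scope.

(** Write a symmetric A as the block matrix [[r, a^T], [a, E]], and let N be
    In + iA.  The angle of A and the angle of E are both sums of arguments of
    eigenvalues, so they are arguments of the determinants of N and of 1 + iE
    as long as arguments are followed continuously along a path of matrices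
    whose starting point has a known argument.  Equating two factorizations of
    one path of determinants therefore gives identities between angles that
    are exact, and not only modulo 2 pi: two continuous determinations of the
    argument that agree at one end of a path agree at the other end
    ([angle_lift_eq]).

    Put p(t) - i q(t) = a^T (1 + itE)^-1 a.  In an orthonormal eigenbasis of E
    this is a sum of w_j / (1 + i t d_j) with w_j >= 0, so p >= 0
    ([bordered_det], [resolvent_exists]).
    - Along (1 - t) + tN, splitting off the block 1 + itE leaves the scalar
      pivot (1 - t) + t^2 p(t) + i (t r - t^2 q(t)), which avoids the closed
      negative axis.  Hence the angle of A is
      theta(E) + arg (p(1) + i (r - q(1))), unless r = 0 and a = 0
      ([Theta_resolvent]).
    - Along the matrices with blocks ir, i sqrt(t) a and 1 + itE, splitting
      off ir instead leaves 1 + itM with the Schur complement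
      M = E - a a^T / r.  Hence, for r <> 0, the same quantity is
      sgn(r) pi/2 + theta(M) ([theta_schur]).

    Three cases result.  If r < 0 the angle of A is
    theta(M) - pi/2 < (n - 1) pi/2 <= c, so A belongs to neither set.
    If r > 0 it is theta(M) + pi/2, and M is the least of the pullbacks
    of A: it is the pullback by V = -a/r, and every pullback has the same
    Schur complement, whose angle cannot exceed that of the pullback since
    p >= 0 bounds the argument above by pi/2 ([theta_schur_le_pullback]).
    The case r = 0, a <> 0 is the limit of the case r > 0, the formulas above
    being continuous in r; the case r = 0, a = 0 holds by definition. *)

Local Open Scope complex_scope.

(** * Arguments on the slit plane *)

(** Membership of x + iy in the complex plane minus the closed negative axis. *)
Definition slit (R : realType) (x y : R) : bool := (y != 0) || (0 < x).

(** The half-angle formula for the principal argument: unlike the definition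
    of [carg], it involves no case distinction and is visibly continuous. *)
Definition slit_arg (R : realType) (x y : R) : R :=
  2 * atan (y / (Num.sqrt (x ^+ 2 + y ^+ 2) + x)).

Lemma slit_denom_gt0 (R : realType) (x y : R) :
  slit x y -> 0 < Num.sqrt (x ^+ 2 + y ^+ 2) + x.
Proof.
move=> /orP[y0|x0]; last by rewrite ltr_wpDl// sqrtr_ge0.
rewrite -ltrBlDr sub0r (le_lt_trans (ler_norm _))// normrN -sqrtr_sqr.
by rewrite ltr_sqrt ?ltrDl ?ltr_wpDl ?sqr_ge0// ?lt0r sqrf_eq0 y0 sqr_ge0.
Qed.

Lemma cos_sin_slit_arg (R : realType) (x y : R)
    (r := Num.sqrt (x ^+ 2 + y ^+ 2)) : slit x y ->
  [/\ 0 < r, cos (slit_arg x y) = x / r & sin (slit_arg x y) = y / r].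
Proof.
move=> s; have d0 := slit_denom_gt0 s; rewrite /slit_arg -/r in d0 *.
have r2 : r ^+ 2 = x ^+ 2 + y ^+ 2 by rewrite sqr_sqrtr// addr_ge0// sqr_ge0.
have r0 : 0 < r.
  rewrite lt0r sqrtr_ge0 andbT; apply/eqP => r0; move: r2 d0.
  rewrite r0 expr0n/= add0r => e; have x0 : x = 0 by nra.
  by rewrite x0 ltxx.
set d := r + x in d0 *; set u := y / d.
have u1 : 1 + u ^+ 2 = 2 * r / d.
  rewrite /u expr_div_n; apply/eqP; rewrite -subr_eq0; apply/eqP.
  transitivity ((d ^+ 2 + y ^+ 2 - 2 * r * d) / d ^+ 2).
    by field; rewrite gt_eqF.
  by rewrite (_ : _ - _ = 0) ?mul0r// /d; ring: r2.
have c2 : cos (atan u) ^+ 2 = d / (2 * r).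
  rewrite cos_atan exprVn sqr_sqrtr; last by rewrite addr_ge0// sqr_ge0.
  by rewrite u1 invf_div.
have c0 : cos (atan u) != 0.
  by rewrite gt_eqF// cos_gt0_pihalf// atan_gtNpi2 atan_ltpi2.
have sE : sin (atan u) = u * cos (atan u).
  by rewrite -{2}(atanK u) /tan divfK.
have d0' := lt0r_neq0 d0; have r0' := lt0r_neq0 r0.
split => //; rewrite mulr_natl.
  by rewrite cos_mulr2n c2 /d; field.
rewrite sin_mulr2n sE mulrCA -expr2 c2 /u; field; exact/andP.
Qed.

Lemma carg_slit (R : realType) (x y : R) :
  slit x y -> carg (x +i* y) = slit_arg x y.
Proof.
move=> s; have [r0 cE _] := cos_sin_slit_arg s; have d0 := slit_denom_gt0 s.
rewrite /carg -cE.
have ub z : atan z <= pi / 2 :> R by rewrite ltW// atan_ltpi2.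
have lb z : - (pi / 2) <= atan z :> R by rewrite ltW// atan_gtNpi2.
case: (leP 0 y) => y0.
  rewrite cosK// in_itv/= /slit_arg; apply/andP; split.
    by rewrite mulr_ge0// -[leLHS](atan0 R) le_atan// divr_ge0// ltW.
  by have := ub (y / (Num.sqrt (x ^+ 2 + y ^+ 2) + x)); lra.
rewrite cosKN ?opprK// /slit_arg; apply/andP; split.
  by have := lb (y / (Num.sqrt (x ^+ 2 + y ^+ 2) + x)); lra.
rewrite mulr_ge0_le0// -[leRHS](atan0 R) le_atan// ler_pdivrMr// mul0r.
exact: ltW.
Qed.

Lemma slit_arg_scale (R : realType) (k x y : R) :
  0 < k -> slit_arg (k * x) (k * y) = slit_arg x y.
Proof.
move=> k0; rewrite /slit_arg !exprMn -mulrDr sqrtrM ?sqr_ge0// sqrtr_sqr.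
by rewrite gtr0_norm// -mulrDr -mulf_div divff ?gt_eqF// mul1r.
Qed.

Lemma slit_arg_le_pihalf (R : realType) (x y : R) :
  0 <= x -> slit_arg x y <= pi / 2.
Proof.
move=> x0; rewrite /slit_arg; set r := Num.sqrt _.
have yr : y <= r.
  rewrite (le_trans (ler_norm _))// -sqrtr_sqr ler_wsqrtr//.
  by rewrite lerDr sqr_ge0.
suff : atan (y / (r + x)) <= pi / 4 by lra.
rewrite -atan1 le_atan//; case: (ltP 0 (r + x)) => rx.
  by rewrite ler_pdivrMr// mul1r (le_trans yr)// lerDl.
have -> : r + x = 0 by apply/eqP; rewrite eq_le rx addr_ge0// sqrtr_ge0.
by rewrite invr0 mulr0.
Qed.

Lemma slit_arg_pos (R : realType) (x : R) : 0 < x -> slit_arg x 0 = 0.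
Proof. by move=> x0; rewrite /slit_arg mul0r atan0 mulr0. Qed.

Lemma slit_arg_imaginary (R : realType) (y : R) :
  y != 0 -> slit_arg 0 y = Num.sg y * (pi / 2).
Proof.
move=> y0; rewrite /slit_arg expr0n add0r addr0 sqrtr_sqr.
have -> : y / `|y| = Num.sg y by rewrite {1}(numEsg y) mulfK// normr_eq0.
have [yp|yn|yE] := ltgtP y 0; last by rewrite yE eqxx in y0.
  by rewrite ltr0_sg// atanN atan1; lra.
by rewrite gtr0_sg// atan1; lra.
Qed.

(** * Continuous determinations of the argument *)

Lemma continuous_slit_arg (R : realType) (f g : R -> R) (t : R) :
  {for t, continuous f} -> {for t, continuous g} -> slit (f t) (g t) ->
  {for t, continuous (fun s => slit_arg (f s) (g s))}.
Proof.
move=> fc gc /slit_denom_gt0 d0.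
have sqc : {for t, continuous (fun s => f s ^+ 2 + g s ^+ 2)}.
  by apply: cvgD; apply: cvgM.
have dc : {for t, continuous
    (fun s => g s / (Num.sqrt (f s ^+ 2 + g s ^+ 2) + f s))}.
  apply: cvgM => //; apply: cvgV; first by rewrite gt_eqF.
  by apply: cvgD => //; apply: continuous_comp sqc _; apply: sqrt_continuous.
have ac := continuous_comp dc (@continuous_atan R _).
by apply: cvgM; [exact: cvg_cst|exact: ac].
Qed.

Lemma continuous_sum (R : realType) (I : Type) (s : seq I) (P : pred I)
    (f : I -> R -> R) (t : R) :
  (forall i, P i -> {for t, continuous (f i)}) ->
  {for t, continuous (fun x => \sum_(i <- s | P i) f i x)}.
Proof. by move=> fc; apply: cvg_big => //; exact: add_continuous. Qed.

(** A relation rather than a function: the sums of arguments considered below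
    leave the range of the principal argument. *)
Definition has_angle (R : realType) (z : R[i]) (phi : R) : Prop :=
  exists2 r, 0 < r & z = (r * cos phi) +i* (r * sin phi).

Lemma has_angle_slit (R : realType) (x y : R) :
  slit x y -> has_angle (x +i* y) (slit_arg x y).
Proof.
move=> /cos_sin_slit_arg[r0 cE sE].
exists (Num.sqrt (x ^+ 2 + y ^+ 2)) => //.
by rewrite cE sE ![_ * (_ / _)]mulrC !divfK ?gt_eqF.
Qed.

Lemma has_angle_atan (R : realType) (y : R) : has_angle (1 +i* y) (atan y).
Proof.
have D0 : 0 < 1 + y ^+ 2 by rewrite ltr_wpDr ?sqr_ge0.
have c0 : cos (atan y) != 0.
  by rewrite gt_eqF// cos_gt0_pihalf// atan_gtNpi2 atan_ltpi2.
exists (cos (atan y))^-1.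
  by rewrite invr_gt0 cos_gt0_pihalf// atan_gtNpi2 atan_ltpi2.
by rewrite mulVf// mulrC -/(tan _) atanK.
Qed.

Lemma has_angle_neq0 (R : realType) (z : R[i]) (phi : R) :
  has_angle z phi -> z != 0.
Proof.
move=> [r r0 ->]; apply/negP => /eqP[/eqP + /eqP].
rewrite !mulf_eq0 gt_eqF//= => /eqP c0 /eqP s0.
have := cos2Dsin2 phi; rewrite c0 s0 !expr0n addr0 => /esym/eqP.
by rewrite oner_eq0.
Qed.

Lemma has_angleM (R : realType) (z1 z2 : R[i]) (a1 a2 : R) :
  has_angle z1 a1 -> has_angle z2 a2 -> has_angle (z1 * z2) (a1 + a2).
Proof.
move=> [r1 r10 ->] [r2 r20 ->]; exists (r1 * r2); first exact: mulr_gt0.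
by rewrite cosD sinD; simpc; congr (_ +i* _); ring.
Qed.

Lemma has_angle_prod (R : realType) (I : Type) (s : seq I) (P : pred I)
    (z : I -> R[i]) (a : I -> R) : (forall i, P i -> has_angle (z i) (a i)) ->
  has_angle (\prod_(i <- s | P i) z i) (\sum_(i <- s | P i) a i).
Proof.
move=> za; elim/big_rec2: _ => [|i x y /za]; last exact: has_angleM.
by exists 1 => //; rewrite cos0 sin0 mulr1 mulr0.
Qed.

Lemma has_angle_cos (R : realType) (z : R[i]) (a b : R) :
  has_angle z a -> has_angle z b -> cos (a - b) = 1.
Proof.
move=> [r r0 ->] [s s0 [cE sE]]; have rs : r = s.
  apply: (pexpIrn (n := 2)) => //; rewrite ?nnegrE ?ltW//.
  rewrite -[LHS]mulr1 -[RHS]mulr1 -{1}(cos2Dsin2 a) -(cos2Dsin2 b) !mulrDr.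
  by rewrite -!exprMn cE sE.
move: cE sE; rewrite -rs => /(mulfI (lt0r_neq0 r0)) cE.
by move=> /(mulfI (lt0r_neq0 r0)) sE; rewrite cosB cE sE -!expr2 cos2Dsin2.
Qed.

(** The difference of two determinations of the argument takes its values in
    the multiples of 2 pi; if it went from 0 to a positive value, it would
    also take a value in ]0, pi]. *)
Lemma angle_lift_le (R : realType) (z : R -> R[i]) (f g : R -> R) :
  {in `[0, 1], forall t, [/\ {for t, continuous f}, {for t, continuous g},
    has_angle (z t) (f t) & has_angle (z t) (g t)]} ->
  f 0 = g 0 -> f 1 <= g 1.
Proof.
move=> H f0; rewrite leNgt; apply/negP => gf.
pose v := Num.min (f 1 - g 1) pi; have pi0 := pi_gt0 R.
have v0 : 0 < v by rewrite lt_min subr_gt0 gf pi_gt0.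
have vpi : v <= pi by rewrite ge_min lexx orbT.
have hc : {within `[0, 1], continuous (fun t => f t - g t)}.
  apply: continuous_subspace_itv => t /H[fc gc _ _]; exact: (cvgB fc gc).
have vb : Num.min (f 0 - g 0) (f 1 - g 1) <= v <=
    Num.max (f 0 - g 0) (f 1 - g 1).
  rewrite f0 subrr minEle maxEle subr_ge0 (ltW gf) ltW//=.
  by rewrite ge_min lexx.
have [t t01 tE] := IVT ler01 hc vb.
have [_ _ fa ga] := H _ t01.
have := has_angle_cos fa ga; rewrite tE -[1](cos0 R) => /cos_inj vE.
have ve : v = 0 by apply: vE; rewrite in_itv/= ?lexx ?vpi !ltW.
by rewrite ve ltxx in v0.
Qed.

(** Uniqueness of the continuous argument along a path: this turns identities
    between determinants into identities between angles. *)
Lemma angle_lift_eq (R : realType) (z : R -> R[i]) (f g : R -> R) :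
  {in `[0, 1], forall t, [/\ {for t, continuous f}, {for t, continuous g},
    has_angle (z t) (f t) & has_angle (z t) (g t)]} ->
  f 0 = g 0 -> f 1 = g 1.
Proof.
move=> H fg0; apply/eqP; rewrite eq_le (angle_lift_le H fg0)/=.
by apply: (@angle_lift_le R z) => // t /H[].
Qed.

(** * Determinants of bordered matrices *)

(** The homogeneous form of the characteristic polynomial, which makes sense
    at y = 0 and thus along a whole path ending at the identity. *)
Lemma det_pencil (F : fieldType) (n : nat) (N : 'M[F]_n) (s : seq F) (x y : F) :
  char_poly N = \prod_(z <- s) ('X - z%:P) ->
  \det (x%:M + y *: N) = \prod_(z <- s) (x + y * z).
Proof.
move=> Ns; have sn : size s = n.
  by apply: succn_inj; rewrite -(size_char_poly N) Ns size_prod_XsubC.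
have [->|y0] := eqVneq y 0.
  rewrite scale0r addr0 det_scalar; under eq_bigr do rewrite mul0r addr0.
  by rewrite big_const_seq count_predT sn -Monoid.iteropE.
have -> : x%:M + y *: N = - y *: ((- x / y)%:M - N).
  apply/matrixP => i j; rewrite !mxE; case: (i == j); rewrite ?mulr1n ?mulr0n.
    by field.
  by ring.
rewrite detZ; have -> : \det ((- x / y)%:M - N) = (char_poly N).[- x / y].
  have <- : map_mx (horner_eval (- x / y)) (char_poly_mx N) = (- x / y)%:M - N.
    apply/matrixP => i j; rewrite !mxE /horner_eval hornerD hornerN hornerC.
    by rewrite hornerMn hornerX.
  by rewrite det_map_mx.
rewrite Ns horner_prod -[in (- y) ^+ n]sn.
elim: s {Ns sn} => [|z s IH]; first by rewrite !big_nil expr0 mul1r.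
by rewrite !big_cons /= exprS -IH hornerXsubC; field.
Qed.

(** Schur complement of the lower right block. *)
Lemma det_bordered_diag (F : fieldType) (n : nat) (z : F) (u : 'rV[F]_n)
    (v : 'cV[F]_n) (d : 'rV[F]_n) : (forall j, d 0 j != 0) ->
  \det (block_mx z%:M u v (diag_mx d)) =
  \prod_j d 0 j * (z - \sum_j u 0 j * v j 0 / d 0 j).
Proof.
move=> d0; pose e := \row_j (d 0 j)^-1.
have de : diag_mx d *m diag_mx e = 1%:M.
  rewrite mulmx_diag -diag_const_mx; congr diag_mx.
  by apply/rowP => j; rewrite !mxE mulfV.
have : \det (block_mx z%:M u v (diag_mx d) *m
             block_mx 1%:M 0 (- (diag_mx e *m v)) 1%:M) =
       \det (block_mx (z%:M - u *m diag_mx e *m v) u 0 (diag_mx d)).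
  rewrite mulmx_block !mulmx1 !mulmx0 !add0r !mulmxN !mulmxA de mul1mx subrr.
  by [].
rewrite det_mulmx det_lblock !det1 !mulr1 det_ublock => ->.
rewrite det_diag mulrC; congr (_ * _); rewrite det_mx11 !mxE mulr1n.
congr (_ - _); apply: eq_bigr => j _; rewrite mul_mx_diag !mxE.
by rewrite mulrAC.
Qed.

(** Schur complement of the upper left entry. *)
Lemma det_bordered_corner (F : fieldType) (n : nat) (z : F) (u : 'rV[F]_n)
    (v : 'cV[F]_n) (D : 'M[F]_n) : z != 0 ->
  \det (block_mx z%:M u v D) = z * \det (D - z^-1 *: (v *m u)).
Proof.
move=> z0.
have : \det (block_mx 1%:M 0 (- (z^-1 *: v)) 1%:M *m block_mx z%:M u v D) =
       \det (block_mx z%:M u 0 (D - z^-1 *: (v *m u))).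
  rewrite mulmx_block !mul1mx !mul0mx !addr0 !mulNmx -!scalemxAl.
  by rewrite mul_mx_scalar scalerA mulVf// scale1r addNr addrC.
by rewrite det_mulmx det_lblock !det1 !mul1r det_ublock det_scalar1.
Qed.

(** Conjugating by a unitary matrix that diagonalizes E makes the lower right
    block diagonal.  As a is real, its two copies in the border become a vector
    u and its conjugate, whence the weights w_j = |u_j|^2 >= 0. *)
Lemma bordered_det (R : realType) (n : nat) (E : 'M[R]_n) (a : 'cV[R]_n) :
  Sym2 E -> exists d w : 'I_n -> R,
  [/\ forall j, 0 <= w j, (forall j, w j = 0) -> a = 0,
      theta E = \sum_j atan (d j) &
      forall (z : R[i]) (s t : R),
        \det (block_mx z%:M ((0 +i* s) *: (map_mx (real_complex R) a)^T)
                ((0 +i* s) *: map_mx (real_complex R) a)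
                (1%:M + (0 +i* t) *: map_mx (real_complex R) E)) =
        \prod_j (1 +i* (t * d j)) *
          (z + \sum_j (s ^+ 2 * w j)%:C / (1 +i* (t * d j)))].
Proof.
move=> Es; pose f := real_complex R; pose B := map_mx f E.
have Bh : B \is hermsymmx.
  apply/is_hermitianmxP; rewrite expr0 scale1r; apply/matrixP => i j.
  by rewrite !mxE -{1}Es mxE; apply/esym/CrealP/complex_realP; eexists.
have /hermitian_normalmx/orthomx_spectralP := Bh.
have /mxOverP dR := hermitian_spectral_diag_real Bh.
have := spectral_unitarymx B; have := spectral_unit B.
move: dR; set P := spectralmx B; set D := spectral_diag B.
move=> dR Pu Puni BE.
pose d j := complex.Re (D 0 j); have dE j : D 0 j = (d j)%:C.
  by rewrite RRe_real ?dR.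
pose b := map_mx f a; pose u := P *m b.
pose w j := complex.Re (u j 0) ^+ 2 + complex.Im (u j 0) ^+ 2.
have bE : b^T *m invmx P = (map_mx Num.conj u)^T.
  rewrite (invmx_unitary Puni) map_mxM trmx_mul.
  congr (_ *m _); last by rewrite map_trmx.
  apply/matrixP => i j; rewrite !mxE.
  by apply/esym/CrealP/complex_realP; eexists.
exists d, w; split.
- by move=> j; rewrite addr_ge0// sqr_ge0.
- move=> w0; have u0 : u = 0.
    apply/matrixP => i j; rewrite (ord1 j) [RHS]mxE.
    apply/eqP; rewrite -normr_eq0 -sqrf_eq0 -add_Re2_Im2.
    by apply/eqP; rewrite -/(w i) w0.
  have b0 : b = 0 by rewrite -(mulKmx Pu b) -/u u0 mulmx0.
  apply/matrixP => i j; have := congr1 (fun m : 'cV_n => m i j) b0.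
  by rewrite !mxE => /complexI.
- have : perm_eq [seq f x | x <- eigenvalues E] [seq D 0 j | j <- enum 'I_n].
    apply: prod_XsubC_eq; rewrite !big_map -enumT big_enum /=.
    have <- : map_poly f (char_poly E) =
        \prod_(x <- eigenvalues E) ('X - (f x)%:P).
      rewrite {1}(char_poly_eigenvalues_sym Es) rmorph_prod.
      apply: eq_bigr => x _.
      by rewrite rmorphB /= map_polyX map_polyC.
    rewrite map_char_poly -/B {1}BE char_poly_conj//.
    rewrite char_poly_trig ?diag_mx_is_trig//; apply: eq_bigr => i _.
    by rewrite !mxE eqxx mulr1n.
  move=> eig; transitivity (\sum_(z <- [seq f x | x <- eigenvalues E])
      atan (complex.Re z)); first by rewrite big_map.
  by rewrite (perm_big _ eig) big_map big_enum.
move=> z s t; rewrite -/f -/B -/b; set c := 0 +i* s.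
pose e := \row_j (1 +i* (t * d j)).
have BD : 1%:M + (0 +i* t) *: B = invmx P *m diag_mx e *m P.
  have -> : diag_mx e = 1%:M + (0 +i* t) *: diag_mx D.
    apply/matrixP => i j; rewrite !mxE dE; case: (i == j); rewrite ?mulr0n.
      by simpc; rewrite !mulr1n; simpc.
    by rewrite mulr0 addr0.
  rewrite mulmxDr mulmxDl mulmx1 mulVmx// -scalemxAr -scalemxAl.
  by rewrite {1}BE.
have -> : block_mx z%:M (c *: b^T) (c *: b) (1%:M + (0 +i* t) *: B) =
    block_mx 1%:M 0 0 (invmx P) *m
    block_mx z%:M (c *: (b^T *m invmx P)) (c *: u) (diag_mx e) *m
    block_mx 1%:M 0 0 P.
  rewrite !mulmx_block !(mul0mx, mulmx0, mul1mx, mulmx1, add0r, addr0).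
  by rewrite -!scalemxAl -scalemxAr mulmxKV// mulKmx// BD.
rewrite !det_mulmx !det_ublock !det1 !mul1r mulrAC -det_mulmx mulVmx// det1.
rewrite mul1r det_bordered_diag; last first.
  by move=> j; rewrite mxE eq_complex /= oner_eq0.
congr (_ * _); first by apply: eq_bigr => j _; rewrite mxE.
rewrite -sumrN; congr (_ + _); apply: eq_bigr => j _.
rewrite -mulNr bE; congr (_ / _); last by rewrite mxE.
(* u must stay folded for the rewriting of entries below *)
clearbody u; rewrite !mxE.
transitivity (- c ^+ 2 * (u j 0 * (u j 0)^*)%R); first by ring.
rewrite -normCK -add_Re2_Im2 -/(w j) /c expr2; simpc.
by congr (_ +i* _); ring.
Qed.

(** * The resolvent functions p and q *)

(** p t - i q t is a^T (1 + itE)^-1 a and the d j are the eigenvalues of E.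
    The last field says so through the determinant of a bordered matrix, with
    an arbitrary corner z and the border scaled by s: the two paths used below
    are s = t, with z running from 1 to ir, and s = sqrt t, with z = ir. *)
Record resolvent (R : realType) (n : nat) (E : 'M[R]_n) (a : 'cV[R]_n)
    (d : 'I_n -> R) (p q : R -> R) : Prop := Resolvent {
  resolvent_theta : theta E = \sum_j atan (d j);
  resolvent_cvg_re : forall t, {for t, continuous p};
  resolvent_cvg_im : forall t, {for t, continuous q};
  resolvent_ge0 : forall t, 0 <= p t;
  resolvent_eq0 : forall t, p t = 0 -> a = 0 /\ q t = 0;
  resolvent_det : forall (z : R[i]) (s t : R),
    \det (block_mx z%:M ((0 +i* s) *: (map_mx (real_complex R) a)^T)
            ((0 +i* s) *: map_mx (real_complex R) a)
            (1%:M + (0 +i* t) *: map_mx (real_complex R) E)) =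
    \prod_j (1 +i* (t * d j)) *
      (z + ((s ^+ 2 * p t) +i* - (s ^+ 2 * q t))) }.

(** p and q are the sums of w_j / (1 + (t d_j)^2) and of
    w_j t d_j / (1 + (t d_j)^2).  A vanishing p forces all weights to vanish,
    hence a = 0. *)
Lemma resolvent_exists (R : realType) (n : nat) (E : 'M[R]_n) (a : 'cV[R]_n) :
  Sym2 E -> exists d p q, resolvent E a d p q.
Proof.
move=> /(@bordered_det R n E a)[d [w [w0 wa thE detE]]].
have D0 x : 0 < 1 + x ^+ 2 :> R by rewrite ltr_wpDr ?sqr_ge0.
have tdc j (t : R) : {for t, continuous (fun t : R => t * d j)}.
  by apply: cvgM; [exact: cvg_id|exact: cvg_cst].
have Dc j (t : R) : {for t, continuous (fun t : R => 1 + (t * d j) ^+ 2)}.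
  by apply: cvgD; [exact: cvg_cst|apply: cvgM; exact: tdc].
have Vc j (t : R) : {for t, continuous (fun t : R => (1 + (t * d j) ^+ 2)^-1)}.
  by apply: cvgV; [rewrite gt_eqF|exact: Dc].
exists d, (fun t => \sum_j w j / (1 + (t * d j) ^+ 2)),
  (fun t => \sum_j w j * (t * d j) / (1 + (t * d j) ^+ 2)).
split => //.
- move=> t; apply: continuous_sum => j _.
  by apply: cvgM; [exact: cvg_cst|exact: Vc].
- move=> t; apply: continuous_sum => j _; apply: cvgM; last exact: Vc.
  by apply: cvgM; [exact: cvg_cst|exact: tdc].
- by move=> t; apply: sumr_ge0 => j _; rewrite divr_ge0// ltW.
- move=> t p0; have wz j : w j = 0.
    have /eqP : w j / (1 + (t * d j) ^+ 2) = 0.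
      by apply: (psumr_eq0P _ p0) => // i _; rewrite divr_ge0// ltW.
    by rewrite mulf_eq0 invr_eq0 (gt_eqF (D0 _)) orbF => /eqP.
  by split; [exact: wa|rewrite big1// => j _; rewrite wz !mul0r].
move=> z s t; rewrite detE; congr (_ * (_ + _)).
have -> : (s ^+ 2 * \sum_j w j / (1 + (t * d j) ^+ 2)) +i*
    - (s ^+ 2 * \sum_j w j * (t * d j) / (1 + (t * d j) ^+ 2)) =
    \sum_j ((s ^+ 2 * (w j / (1 + (t * d j) ^+ 2))) +i*
       - (s ^+ 2 * (w j * (t * d j) / (1 + (t * d j) ^+ 2)))).
  rewrite !mulr_sumr -sumrN.
  by elim/big_rec3: _ => // j x y1 y2 _ <-; simpc.
apply: eq_bigr => j _.
have D1 : 1 + (t * d j) ^+ 2 != 0 by rewrite gt_eqF.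
simpc.
by congr (_ +i* _); field.
Qed.

(** * Two formulas for the angle *)

Lemma bordered_pencil (R : realType) (n : nat) (r : R) (a : 'cV[R]_n)
    (E : 'M[R]_n) (t : R) :
  (1 - t)%:C%:M + t%:C *: spacetime_mx (block_mx r%:M a^T a E) =
  block_mx ((1 - t) +i* (t * r))%:M
    ((0 +i* t) *: (map_mx (real_complex R) a)^T)
    ((0 +i* t) *: map_mx (real_complex R) a)
    (1%:M + (0 +i* t) *: map_mx (real_complex R) E).
Proof.
rewrite /spacetime_mx /In_mx !map_block_mx !scale_block_mx add_block_mx.
rewrite !map_mx0 map_mx1 map_scalar_mx.
rewrite scale_block_mx (scalar_mx_block 1 n) add_block_mx.
have eq_block m1 m2 n1 n2 (A A' : 'M[R[i]]_(m1, n1)) (B B' : 'M_(m1, n2))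
    (C C' : 'M_(m2, n1)) (D D' : 'M_(m2, n2)) :
    A = A' -> B = B' -> C = C' -> D = D' ->
    block_mx A B C D = block_mx A' B' C' D'.
  by move=> -> -> -> ->.
apply: eq_block.
- by rewrite add0r !scale_scalar_mx -raddfD; congr _%:M; simpc.
- by rewrite !add0r scalerA map_trmx; congr (_ *: _); simpc.
- by rewrite !add0r scalerA; congr (_ *: _); simpc.
- rewrite scalerDr scalerA addrA scalemx1 -raddfD.
  congr (_ + _ *: _); last by simpc.
  by congr _%:M; simpc; congr (_ +i* _); ring.
Qed.

(** The path (1 - t) + tN, seen on one side through the eigenvalues of N and on
    the other through the Schur complement of the block 1 + itE.  The second
    expression shows that the determinant never vanishes on the path, which
    is what keeps the eigenvalues of N off the closed negative axis. *)
Lemma Theta_resolvent (R : realType) (n : nat) (E : 'M[R]_n) (a : 'cV[R]_n)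
    (d : 'I_n -> R) (p q : R -> R) (r : R) :
  resolvent E a d p q -> (r != 0) || (a != 0) ->
  Theta (block_mx r%:M a^T a E) = theta E + slit_arg (p 1) (r - q 1).
Proof.
move=> [thE pc qc p0 pq detE] ra.
set A := block_mx _ _ _ _; set N := spacetime_mx A.
have AS : A \notin @singular_set R n.
  rewrite notin_setE => -[B _] /eq_block_mx[r0 _ a0 _]; move: ra.
  rewrite -a0 eqxx orbF; have := congr1 (fun m : 'M_1 => m ord0 ord0) r0.
  by rewrite !mxE eqxx mulr1n => <-; rewrite eqxx.
rewrite /Theta (negbTE AS) -/N; set s := eigenvalues N.
have Ns : char_poly N = \prod_(z <- s) ('X - z%:P).
  exact: char_poly_eigenvalues_complex.
pose x t := (1 - t) + t ^+ 2 * p t; pose y t := t * r - t ^+ 2 * q t.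
pose z t := \det ((1 - t)%:C%:M + t%:C *: N).
have z1 t : z t = \prod_(l <- s) ((1 - t)%:C + t%:C * l) by exact: det_pencil.
have z2 t : z t = \prod_j (1 +i* (t * d j)) * (x t +i* y t).
  by rewrite /z bordered_pencil detE; congr (_ * _); simpc.
have xy t : t \in `[0, 1] -> slit (x t) (y t).
  rewrite in_itv/= => /andP[t0 t1]; rewrite /slit /x orbC.
  have [//|x0] := ltP 0.
  have x1 : 0 <= t ^+ 2 * p t by rewrite mulr_ge0 ?sqr_ge0.
  have tE : t = 1 by lra.
  move: x0 x1; rewrite /y tE expr1n !mul1r subrr add0r => x0 x1.
  have /pq[a0 q0] : p 1 = 0 by lra.
  by move: ra; rewrite a0 eqxx orbF q0 subr0.
pose g t := \sum_j atan (t * d j) + slit_arg (x t) (y t).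
have zg t : t \in `[0, 1] -> has_angle (z t) (g t).
  move=> t01; rewrite z2; apply: has_angleM; last exact/has_angle_slit/xy.
  by apply: has_angle_prod => j _; exact: has_angle_atan.
have sl l : l \in s -> slit (complex.Re l) (complex.Im l).
  move=> ls; rewrite /slit orbC; have [//|Re0] := ltP 0; apply/eqP => Im0.
  (* (1 - t) + t l vanishes for this t if l <= 0 *)
  pose t := (1 - complex.Re l)^-1; have t0 : 0 < 1 - complex.Re l by lra.
  have /zg/has_angle_neq0 : t \in `[0, 1].
    by rewrite in_itv/= invr_ge0 ltW//= invf_le1// lerDl oppr_ge0.
  rewrite z1 prodf_seq_neq0 => /allP/(_ _ ls)/=/negP; apply; apply/eqP.
  case: l {ls} Re0 Im0 @t t0 => u v /= u0 -> t0; simpc; congr (_ +i* _).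
  by field; rewrite gt_eqF.
pose f t := \sum_(l <- s | l \in s)
  slit_arg ((1 - t) + t * complex.Re l) (t * complex.Im l).
have slt l t : l \in s -> t \in `[0, 1] ->
    slit ((1 - t) + t * complex.Re l) (t * complex.Im l).
  move=> /sl; rewrite in_itv/= => ls /andP[t0 t1].
  have [->|tn0] := eqVneq t 0.
    by rewrite /slit subr0 !mul0r addr0 ltr01 orbT.
  have tp : 0 < t by rewrite lt0r tn0.
  case/orP: ls => [l0|l0]; first by rewrite /slit mulf_neq0.
  by rewrite /slit ltr_wpDl ?orbT ?mulr_gt0 ?subr_ge0.
have zf t : t \in `[0, 1] -> has_angle (z t) (f t).
  move=> t01; rewrite z1 big_seq_cond /f; under eq_bigl do rewrite andbT.
  apply: has_angle_prod => l ls.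
  have -> : (1 - t)%:C + t%:C * l =
      ((1 - t) + t * complex.Re l) +i* (t * complex.Im l).
    by case: l {ls} => u v; simpc.
  exact/has_angle_slit/slt.
have fg1 : f 1 = g 1.
  apply: (@angle_lift_eq R z) => [t t01|]; last first.
    rewrite /f /g !big1 ?add0r => [|j _|l _]; last 2 first.
    - by rewrite mul0r atan0.
    - by rewrite !mul0r subr0 addr0 slit_arg_pos.
    by rewrite /x /y !expr0n !mul0r !subr0 addr0 slit_arg_pos.
  have t1c : {for t, continuous (fun t : R => 1 - t)}.
    by apply: cvgB; [exact: cvg_cst|exact: cvg_id].
  have tkc k : {for t, continuous (fun t : R => t * k)}.
    by apply: cvgM; [exact: cvg_id|exact: cvg_cst].
  have ttc : {for t, continuous (fun t : R => t ^+ 2)}.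
    by apply: cvgM; exact: cvg_id.
  split; [| |exact: zf|exact: zg].
  - apply: continuous_sum => l ls; apply: continuous_slit_arg; last exact: slt.
      by apply: cvgD; [exact: t1c|exact: tkc].
    exact: tkc.
  - apply: cvgD.
      apply: continuous_sum => j _.
      exact: (continuous_comp (tkc (d j)) (@continuous_atan R _)).
    apply: continuous_slit_arg; last exact: xy.
      by apply: cvgD; [exact: t1c|apply: cvgM; [exact: ttc|exact: pc]].
    by apply: cvgB; [exact: tkc|apply: cvgM; [exact: ttc|exact: qc]].
transitivity (f 1).
  rewrite big_seq_cond /f; under eq_bigl do rewrite andbT.
  apply: eq_bigr => l /sl lsl; rewrite subrr add0r !mul1r -carg_slit//.
  by case: (l).
rewrite fg1 /g /x /y expr1n !mul1r subrr add0r thE; congr (_ + _).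
by apply: eq_bigr => j _; rewrite mul1r.
Qed.

(** Here the corner ir stays fixed and the border is scaled by sqrt t, so that
    the Schur complement of the corner is 1 + itM, with M independent of t.
    At t = 0 both sides reduce to arg (ir) = sgn(r) pi/2. *)
Lemma theta_schur (R : realType) (n : nat) (E : 'M[R]_n) (a : 'cV[R]_n)
    (d : 'I_n -> R) (p q : R -> R) (r : R) :
  Sym2 E -> resolvent E a d p q -> r != 0 ->
  Num.sg r * (pi / 2) + theta (E - r^-1 *: (a *m a^T)) =
  theta E + slit_arg (p 1) (r - q 1).
Proof.
move=> Es [thE pc qc p0 pq detE] r0; set M := E - _.
have Ms : Sym2 M.
  by rewrite /Sym2/= /M linearB linearZ /= trmx_mul trmxK Es.
pose x t := t * p t; pose y t := r - t * q t.
have charM : char_poly (map_mx (real_complex R) M) =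
    \prod_(m <- [seq m%:C | m <- eigenvalues M]) ('X - m%:P).
  rewrite -map_char_poly (char_poly_eigenvalues_sym Ms) rmorph_prod big_map.
  by apply: eq_bigr => m _; rewrite rmorphB /= map_polyX map_polyC.
pose z t := \prod_j (1 +i* (t * d j)) * (x t +i* y t).
have zM t : 0 <= t ->
    z t = (0 +i* r) * \prod_(m <- eigenvalues M) (1 +i* (t * m)).
  move=> t0; have rC : (0 +i* r) != 0 :> R[i] by rewrite eq_complex /= eqxx.
  have schurE : 1%:M + (0 +i* t) *: map_mx (real_complex R) E - (0 +i* r)^-1 *:
      (((0 +i* Num.sqrt t) *: map_mx (real_complex R) a) *m
       ((0 +i* Num.sqrt t) *: (map_mx (real_complex R) a)^T)) =
      1%:M + (0 +i* t) *: map_mx (real_complex R) M.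
    rewrite map_mxB map_mxZ map_mxM scalerBr addrA.
    rewrite -scalemxAl -scalemxAr !scalerA map_trmx.
    congr (_ - _ *: _); apply: (mulfI rC); rewrite !mulrA mulfV// mul1r; simpc.
    by rewrite -expr2 sqr_sqrtr//; congr (_ +i* _); field.
  transitivity ((0 +i* r) *
      \det (1%:M + (0 +i* t) *: map_mx (real_complex R) M)); last first.
    rewrite (det_pencil _ _ charM) big_map; congr (_ * _).
    by apply: eq_bigr => m _; simpc.
  transitivity (\prod_j (1 +i* (t * d j)) * ((0 +i* r) +
      ((Num.sqrt t ^+ 2 * p t) +i* - (Num.sqrt t ^+ 2 * q t)))).
    by rewrite sqr_sqrtr//; congr (_ * _); simpc.
  rewrite -(detE (0 +i* r) (Num.sqrt t) t).
  by rewrite (det_bordered_corner _ _ _ rC) schurE.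
have xy t : 0 <= t -> slit (x t) (y t).
  move=> t0; rewrite /slit /x /y orbC; have [//|x0] := ltP 0.
  have /eqP : t * p t = 0 by apply/eqP; rewrite eq_le x0 mulr_ge0.
  rewrite mulf_eq0 => /orP[/eqP->|/eqP/pq[_ ->]]; first by rewrite mul0r subr0.
  by rewrite mulr0 subr0.
pose g t := \sum_j atan (t * d j) + slit_arg (x t) (y t).
pose f t := slit_arg 0 r + \sum_(m <- eigenvalues M) atan (t * m).
have tkc k (t : R) : {for t, continuous (fun t : R => t * k)}.
  by apply: cvgM; [exact: cvg_id|exact: cvg_cst].
have atc k (t : R) : {for t, continuous (fun t : R => atan (t * k))}.
  exact: (continuous_comp (tkc k t) (@continuous_atan R _)).
have : f 1 = g 1.
  apply: (@angle_lift_eq R z) => [t|]; last first.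
    rewrite /f /g !big1 => [|j _|m _]; last 2 first.
    - by rewrite mul0r atan0.
    - by rewrite mul0r atan0.
    by rewrite /x /y !mul0r subr0 addr0 add0r.
  rewrite in_itv/= => /andP[t0 t1]; split.
  - by apply: cvgD; [exact: cvg_cst|apply: continuous_sum => m _; exact: atc].
  - apply: cvgD; first by apply: continuous_sum => j _; exact: atc.
    apply: continuous_slit_arg; last exact: xy.
      by apply: cvgM; [exact: cvg_id|exact: pc].
    by apply: cvgB; [exact: cvg_cst|apply: cvgM; [exact: cvg_id|exact: qc]].
  - rewrite zM//; apply: has_angleM.
      by apply: has_angle_slit; rewrite /slit r0.
    by apply: has_angle_prod => m _; exact: has_angle_atan.
  - apply: has_angleM; last exact/has_angle_slit/xy.
    by apply: has_angle_prod => j _; exact: has_angle_atan.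
rewrite /f /g /x /y !mul1r slit_arg_imaginary// thE /theta.
by under eq_bigr do rewrite mul1r; under [in RHS]eq_bigr do rewrite mul1r.
Qed.

Lemma theta_lt (R : realType) (n : nat) (E : 'M[R]_n) :
  (0 < n)%N -> Sym2 E -> theta E < n%:R * (pi / 2).
Proof.
case: n E => // n E _ Es; have [d [p [q]]] := resolvent_exists 0 Es.
case=> -> _ _ _ _ _.
rewrite mulr_natl -[n.+1 in X in _ < X]card_ord -sumr_const.
apply: ltr_sum => [|j _]; last exact: atan_ltpi2.
by apply/hasP; exists ord0 => //; rewrite mem_index_enum.
Qed.

(** * Pullbacks and the equivalence *)

Lemma le_right_limit (R : realType) (h1 h2 : R -> R) :
  {for 0, continuous h1} -> {for 0, continuous h2} ->
  (forall s, 0 < s -> h1 s <= h2 s) -> h1 0 <= h2 0.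
Proof.
move=> c1 c2 le12; rewrite -subr_ge0.
apply: (cvgr_to_ge (cvg_at_right_filter (cvgB c2 c1))).
near=> s; rewrite subr_ge0; apply: le12; near: s; exact: nbhs_right_gt.
Unshelve. all: by end_near. Qed.

(** This is l_V^* A, the lower right block of A after the shear by V; the
    corner and the border of the sheared matrix are r and a + rV. *)
Definition pullback (R : realType) (n : nat) (r : R) (a : 'cV[R]_n)
    (E : 'M[R]_n) (V : 'cV[R]_n) : 'M[R]_n :=
  r *: (V *m V^T) + V *m a^T + a *m V^T + E.

Lemma pullback_sym (R : realType) (n : nat) (r : R) (a : 'cV[R]_n)
    (E : 'M[R]_n) (V : 'cV[R]_n) : Sym2 E -> Sym2 (pullback r a E V).
Proof.
rewrite /Sym2/= => Es.
rewrite /pullback !linearD linearZ /= !trmx_mul !trmxK Es.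
by congr (_ + _); rewrite -!addrA; congr (_ + _); rewrite addrC.
Qed.

(** The sheared matrix has corner r, border a + rV and lower right block the
    pullback, so its Schur complement is again E - a a^T / r.  The formula of
    [theta_schur] for the pullback then bounds its angle from below, because
    the argument of a number with nonnegative real part is at most pi/2. *)
Lemma theta_schur_le_pullback (R : realType) (n : nat) (r : R) (a : 'cV[R]_n)
    (E : 'M[R]_n) (V : 'cV[R]_n) : Sym2 E -> 0 < r ->
  theta (E - r^-1 *: (a *m a^T)) <= theta (pullback r a E V).
Proof.
move=> Es r0; have Ps := pullback_sym r a V Es.
have [d [p [q res]]] := resolvent_exists (a + r *: V) Ps.
have Pschur : pullback r a E V - r^-1 *: ((a + r *: V) *m (a + r *: V)^T) =
    E - r^-1 *: (a *m a^T).
  apply/matrixP => i j; rewrite /pullback !mxE !big_ord1 !mxE.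
  by field; rewrite gt_eqF.
have := theta_schur Ps res (lt0r_neq0 r0); rewrite Pschur (gtr0_sg r0) mul1r.
have le_of_sum (x y s h : R) : h + x = y + s -> s <= h -> x <= y by lra.
move=> /le_of_sum; apply.
by rewrite slit_arg_le_pihalf// (resolvent_ge0 res).
Qed.

(** For r = 0 and a <> 0 the corner is replaced by s > 0, where the Schur
    complement E - a a^T / s is the pullback of the unperturbed matrix by
    V = -a / (2s).  Conversely, the pullback by a fixed V gains the term
    s V V^T under the perturbation, and its angle tends to that of the
    unperturbed pullback: this is [theta_schur] with corner -1/s and
    border V. *)
Lemma angle_iff_pullback (R : realType) (n : nat) (c r : R) (a : 'cV[R]_n)
    (E : 'M[R]_n) : (0 < n)%N -> (n%:R - 1) / 2 * pi <= c -> Sym2 E ->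
  c <= Theta (block_mx r%:M a^T a E) <->
  0 <= r /\ forall V, c - pi / 2 <= theta (pullback r a E V).
Proof.
have le_of_sum (x y u h : R) :
  -1 * (h / 2) + y = u -> x <= y -> 1 * (h / 2) + x <= u + h by lra.
move=> n0 c_ge Es; have [d [p [q res]]] := resolvent_exists a Es.
have schur s : s != 0 -> theta E + slit_arg (p 1) (s - q 1) =
    Num.sg s * (pi / 2) + theta (E - s^-1 *: (a *m a^T)).
  by move=> s0; rewrite (theta_schur Es res s0).
have [rn|rp|->] := ltgtP r 0.
- split=> [|[]//].
  rewrite (Theta_resolvent res) ?lt_eqF// schur ?lt_eqF// ltr0_sg//.
  have Ms : Sym2 (E - r^-1 *: (a *m a^T)).
    by rewrite /Sym2/= linearB linearZ /= trmx_mul trmxK Es.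
  by have := theta_lt n0 Ms; lra.
- rewrite (Theta_resolvent res) ?gt_eqF// schur ?gt_eqF// gtr0_sg// mul1r.
  split=> [cT|[_ /(_ (- r^-1 *: a))]].
    split=> [//|V].
    rewrite lerBlDl; apply: le_trans cT _; rewrite lerD2l.
    exact: theta_schur_le_pullback.
  have -> : pullback r a E (- r^-1 *: a) = E - r^-1 *: (a *m a^T).
    apply/matrixP => i j; rewrite /pullback !mxE !big_ord1 !mxE.
    by field; rewrite gt_eqF.
  by rewrite lerBlDl.
have [a0|a0] := eqVneq a 0.
  have -> : Theta (block_mx 0%:M a^T a E) = theta E + pi / 2.
    rewrite /Theta block_mxKdr ifT// inE; exists E => //.
    by rewrite a0 trmx0 raddf0.
  have P V : pullback 0 a E V = E.
    by rewrite /pullback a0 trmx0 scale0r mulmx0 mul0mx !add0r.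
  split=> [cT|[_ /(_ 0)]]; last by rewrite P; lra.
  by split=> [//|V]; rewrite P; lra.
rewrite (Theta_resolvent res) ?a0 ?orbT//.
have p1 : 0 < p 1.
  rewrite lt0r (resolvent_ge0 res) andbT.
  apply/eqP => /(resolvent_eq0 res)[aE _].
  by rewrite aE eqxx in a0.
pose h (s : R) := theta E + slit_arg (p 1) (s - q 1).
have hc : {for 0, continuous h}.
  have argc : {for 0, continuous (fun s : R => slit_arg (p 1) (s - q 1))}.
    apply: continuous_slit_arg; [exact: cvg_cst| |by rewrite /slit p1 orbT].
    by apply: cvgB; [exact: cvg_id|exact: cvg_cst].
  by apply: cvgD; [exact: cvg_cst|exact: argc].
split=> [cT|[_ PV]].
  split=> [//|V]; apply: le_trans (lerB cT (lexx _)) _; rewrite lerBlDr.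
  have Ps := pullback_sym 0 a V Es.
  have [d' [p' [q' res']]] := resolvent_exists V Ps.
  (* for s > 0: the angle with corner s is h s, and that of its pullback by V
     is k s - pi / 2 *)
  pose k (s : R) :=
    theta (pullback 0 a E V) + slit_arg (s * p' 1) (-1 - s * q' 1) + pi.
  have kc : {for 0, continuous k}.
    have argc : {for 0, continuous (fun s : R =>
        slit_arg (s * p' 1) (-1 - s * q' 1))}.
      apply: continuous_slit_arg.
      - by apply: cvgM; [exact: cvg_id|exact: cvg_cst].
      - apply: cvgB; first exact: cvg_cst.
        by apply: cvgM; [exact: cvg_id|exact: cvg_cst].
      - by rewrite /slit mul0r subr0 oppr_eq0 oner_eq0.
    apply: cvgD; last exact: cvg_cst.
    by apply: cvgD; [exact: cvg_cst|exact: argc].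
  have k0 : k 0 = theta (pullback 0 a E V) + pi / 2.
    rewrite /k !mul0r subr0 slit_arg_imaginary ?oppr_eq0 ?oner_eq0//.
    by rewrite sgrN sgr1 -addrA; congr (_ + _); lra.
  suff hk : h 0 <= k 0 by apply: le_trans hk _; rewrite k0.
  apply: le_right_limit hc kc _ => s s0.
  have sN0 : - s^-1 != 0 by rewrite oppr_eq0 invr_eq0 gt_eqF.
  rewrite /h schur ?gt_eqF// gtr0_sg//.
  have := theta_schur Ps res' sN0; rewrite ltr0_sg ?oppr_lt0 ?invr_gt0//.
  have -> : pullback 0 a E V - (- s^-1)^-1 *: (V *m V^T) = pullback s a E V.
    apply/matrixP => i j; rewrite /pullback !mxE !big_ord1 !mxE.
    by field; rewrite gt_eqF.
  rewrite -(slit_arg_scale (p' 1) _ s0) mulrBr mulrN mulfV ?gt_eqF// /k.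
  move=> /le_of_sum; apply.
  exact: theta_schur_le_pullback.
apply: (@le_right_limit R (fun=> c) h) => //; first exact: cvg_cst.
move=> s s0; rewrite /h schur ?gt_eqF// gtr0_sg//.
have := PV (- (2 * s)^-1 *: a).
have -> : pullback 0 a E (- (2 * s)^-1 *: a) = E - s^-1 *: (a *m a^T).
  apply/matrixP => i j; rewrite /pullback !mxE !big_ord1 !mxE.
  by field; rewrite gt_eqF.
by rewrite mul1r lerBlDl.
Qed.

Theorem proposition2p2 (R : realType) (n : nat) (c : R) (hn : (1 <= n)%N)
    (hc_ge : (n%:R - 1) / 2 * pi <= c) (hc_lt : c < (n%:R + 1) / 2 * pi) :
  @spacetime_angle_set R n c = star (@P1 R) (@angle_set R n (c - pi / 2)).
Proof.
have PE (B : 'M[R]_1) (C : 'cV[R]_n) E V :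
    V *m B *m V^T + V *m C^T + C *m V^T + E = pullback (B 0 0) C E V.
  by rewrite [in LHS](mx11_scalar B) mul_mx_scalar -scalemxAl.
apply/seteqP; split=> [A [As cT]|_ [B [C [E [_ Es -> B0 GV]]]]].
  pose B := ulsubmx A; pose C := dlsubmx A; pose E := drsubmx A.
  have Es : Sym2 E by rewrite /Sym2/= /E trmx_drsub As.
  have AE : A = block_mx B C^T C E by rewrite /C trmx_dlsub As submxK.
  have Bs : Sym2 B by rewrite /Sym2/= /B trmx_ulsub As.
  move: cT; rewrite [in Theta A]AE [B in block_mx B](mx11_scalar B).
  move=> /(angle_iff_pullback _ _ hn hc_ge Es)[B0 PV].
  exists B, C, E; split => // V; rewrite PE.
  by split; [exact: pullback_sym|exact: PV].
split.
  rewrite /Sym2/= tr_block_mx trmxK Es; congr block_mx.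
  by rewrite (mx11_scalar B) tr_scalar_mx.
rewrite [B in block_mx B](mx11_scalar B).
apply/(angle_iff_pullback _ _ hn hc_ge Es); split=> // V.
by rewrite -PE; case: (GV V).
Qed.
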